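(* Let $M$ be an $m$-dimensional differential manifold, let $N$ be a connected $n$-dimensional differential manifold with $n\geq 2$, and let $f:M\to N$ be a $C^1$-map such that (1) $f(M)$ is closed in $N$; (2) $f$ has only countably many critical points. Then $f$ is surjective.
   Context: Differential manifolds are smooth manifolds in the usual sense. A point $p\in M$ is a critical point of a $C^1$-map $f:M\to N$ if the differential $df_p:T_pM\to T_{f(p)}N$ is not surjective. ''Countably many'' includes finitely many.
   Formalization: M is additionally assumed nonempty and of dimension m ≥ 1; otherwise the claim fails, e.g. for the inclusion of a point (m = 0), or of the empty manifold, into R^2. *)

(* Defs.v *)
From mathcomp Require Import all_boot all_order all_algebra.
From mathcomp Require Import all_classical all_reals all_analysis.

Set Implicit Arguments.
Unset Strict Implicit.
Unset Printing Implicit Defensive.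

Import Order.TTheory GRing.Theory Num.Theory.
Import numFieldNormedType.Exports.

Local Open Scope classical_set_scope.
Local Open Scope ring_scope.

(* C^k maps on an open set U. In finite dimension, continuity of the           *)
(* differential x |-> 'd f x amounts to continuity of x |-> 'd f x v for every *)
(* v, and likewise for the higher derivatives.                                *)
Fixpoint Ck_on (R : realType) (V W : normedModType R) (k : nat) (U : set V)
    (f : V -> W) : Prop :=
  if k is k'.+1 then
    (forall x, U x -> differentiable f x) /\
    (forall v, Ck_on k' U (fun x => 'd f x v))
  else forall x, U x -> {for x, continuous f}.

Definition smooth_on (R : realType) (V W : normedModType R) (U : set V)
    (f : V -> W) : Prop :=
  forall k, Ck_on k U f.

(* cmap and cinv are total functions, but only the values of cmap on cdom and  *)
(* those of cinv on cmap @` cdom are meaningful.                               *)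
Record chart (R : realType) (n : nat) (M : topologicalType) := Chart {
  cdom : set M;
  cmap : M -> 'rV[R]_n;
  cinv : 'rV[R]_n -> M;
  cdom_open : open cdom;
  cimg_open : open (cmap @` cdom);
  cmapK : forall p, cdom p -> cinv (cmap p) = p;
  cmap_continuous : forall p, cdom p -> {for p, continuous cmap};
  cinv_continuous : forall x, (cmap @` cdom) x -> {for x, continuous cinv}
}.

Definition transition (R : realType) (n : nat) (M : topologicalType)
    (a b : chart R n M) : 'rV[R]_n -> 'rV[R]_n :=
  cmap b \o cinv a.

Record manifold (R : realType) (n : nat) := Manifold {
  mcarrier :> topologicalType;
  mhausdorff : hausdorff_space mcarrier;
  msecond_countable : @second_countable mcarrier;
  atlas : set (chart R n mcarrier);
  atlas_cover : forall p : mcarrier, exists2 a, atlas a & cdom a p;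
  atlas_smooth : forall a b, atlas a -> atlas b ->
    smooth_on (cmap a @` (cdom a `&` cdom b)) (transition a b)
}.

Definition chart_at (R : realType) (n : nat) (M : manifold R n) (p : M) :=
  {a : chart R n M | atlas a /\ cdom a p}.

Definition base_chart (R : realType) (n : nat) (M : manifold R n) (p : M) :
    chart_at p :=
  let: exist2 a Aa ap := cid2 (atlas_cover p) in exist _ a (conj Aa ap).

(* A tangent vector at p is given by its coordinates in all the charts at p,   *)
(* transforming under the differentials of the transition maps.               *)
Record tangent (R : realType) (n : nat) (M : manifold R n) (p : M) := Tangent {
  tcoord : chart_at p -> 'rV[R]_n;
  tcoordE : forall a b : chart_at p,
    tcoord b = 'd (transition (sval a) (sval b)) (cmap (sval a) p) (tcoord a)
}.

Lemma near_diff_comp (R : realType) (U V W : normedModType R) (f : U -> V)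
    (g : V -> W) (h : U -> W) (x v : U) (y : V) :
  f x = y -> differentiable f x -> differentiable g y -> differentiable h x ->
  (\near x, g (f x) = h x) -> 'd h x v = 'd g y ('d f x v).
Proof.
move=> <- df dg dh gfh.
have [->|v0] := eqVneq v 0; first by rewrite !linear0.
have dgf : differentiable (g \o f) x by exact: differentiable_comp.
transitivity ('d (g \o f) x v); last by rewrite (diff_comp df dg).
rewrite -(deriveE v dh) -(deriveE v dgf); apply: near_eq_derive => //.
by apply: filterS gfh => z /= ->.
Qed.

Section C1Maps.
Variables (R : realType) (m n : nat) (M : manifold R m) (N : manifold R n).

Definition local_repr (f : M -> N) (a : chart R m M) (b : chart R n N) :
    'rV[R]_m -> 'rV[R]_n :=
  cmap b \o f \o cinv a.

Definition C1_map (f : M -> N) : Prop :=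
  continuous f /\
  forall a b, atlas a -> atlas b ->
    Ck_on 1 (cmap a @` (cdom a `&` f @^-1` cdom b)) (local_repr f a b).

Variables (f : M -> N) (fC1 : C1_map f).

Lemma local_repr_differentiable p (a : chart_at p) (b : chart_at (f p)) :
  differentiable (local_repr f (sval a) (sval b)) (cmap (sval a) p).
Proof.
case: a b => a [Aa ap] [b [Ab bp]] /=.
by have [+ _] := fC1.2 a b Aa Ab; apply; exists p.
Qed.

Lemma diff_local_repr_target p (a : chart_at p) (b b' : chart_at (f p)) v :
  'd (local_repr f (sval a) (sval b')) (cmap (sval a) p) v =
  'd (transition (sval b) (sval b')) (cmap (sval b) (f p))
    ('d (local_repr f (sval a) (sval b)) (cmap (sval a) p) v).
Proof.
have dF := local_repr_differentiable a b.
have dG := local_repr_differentiable a b'.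
case: a b b' dF dG => a [Aa ap] [b [Ab bp]] [b' [Ab' b'p]] /= dF dG.
have Fp : local_repr f a b (cmap a p) = cmap b (f p).
  by rewrite /local_repr /= cmapK.
have dT : differentiable (transition b b') (cmap b (f p)).
  by have [+ _] := atlas_smooth Ab Ab' 1; apply; exists (f p).
apply: (near_diff_comp _ Fp dF dT dG).
have cfi : {for cmap a p, continuous (f \o cinv a)}.
  apply: continuous_comp; last exact: fC1.1.
  by apply: cinv_continuous; exists p.
have : nbhs ((f \o cinv a) (cmap a p)) (cdom b).
  by rewrite /= cmapK//; apply: open_nbhs_nbhs; split => //; exact: cdom_open.
move=> /cfi nb; have {}nb : \forall x \near cmap a p, cdom b (f (cinv a x)).
  exact: nb.
by apply: filterS nb => x bx; rewrite /transition /local_repr /= cmapK.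
Qed.

Lemma diff_local_repr_source p (a a' : chart_at p) (b : chart_at (f p))
    (v : tangent p) :
  'd (local_repr f (sval a) (sval b)) (cmap (sval a) p) (tcoord v a) =
  'd (local_repr f (sval a') (sval b)) (cmap (sval a') p) (tcoord v a').
Proof.
rewrite (tcoordE v a a').
have dF := local_repr_differentiable a b.
have dG := local_repr_differentiable a' b.
move: (tcoord v a) => w.
case: a a' b dF dG => a [Aa ap] [a' [Aa' a'p]] [b [Ab bp]] /= dF dG.
have Tp : transition a a' (cmap a p) = cmap a' p.
  by rewrite /transition /= cmapK.
have dT : differentiable (transition a a') (cmap a p).
  by have [+ _] := atlas_smooth Aa Aa' 1; apply; exists p.
apply: (near_diff_comp _ Tp dT dG dF).
have ci : {for cmap a p, continuous (cinv a)}.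
  by apply: cinv_continuous; exists p.
have : nbhs (cinv a (cmap a p)) (cdom a').
  by rewrite cmapK//; apply: open_nbhs_nbhs; split => //; exact: cdom_open.
move=> /ci na; have {}na : \forall x \near cmap a p, cdom a' (cinv a x).
  exact: na.
by apply: filterS na => x a'x; rewrite /transition /local_repr /= cmapK.
Qed.

(* df_p : T_p M -> T_(f p) N; it does not depend on base_chart, see            *)
(* differentialE.                                                             *)
Definition differential p (v : tangent p) : tangent (f p) :=
  let a := base_chart p in
  Tangent (tcoord := fun b =>
      'd (local_repr f (sval a) (sval b)) (cmap (sval a) p) (tcoord v a))
    (fun b b' => diff_local_repr_target a b b' (tcoord v a)).

Lemma differentialE p (v : tangent p) (a : chart_at p) (b : chart_at (f p)) :
  tcoord (differential v) b =
  'd (local_repr f (sval a) (sval b)) (cmap (sval a) p) (tcoord v a).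
Proof. exact: diff_local_repr_source. Qed.

Definition critical_points : set M :=
  [set p | ~ set_surj [set: tangent p] [set: tangent (f p)] (@differential p)].

End C1Maps.

(* Main.v *)
Require Import Defs.
From mathcomp Require Import all_boot all_order all_algebra.
From mathcomp Require Import all_classical all_reals all_analysis.
From mathcomp Require Import lra.

(** Near the image of a regular point, the range [A] of [f] is a neighbourhood,
    because a C^1 map with surjective differential is open there
    ([submersion_nbhs], brought to manifolds by [nbhs_range_regular]). The
    frontier of [A] therefore consists of critical values, and it is countable.
    In dimension at least 2 a countable set does not disconnect a ball
    ([ball_minus_countable_connected]), so a ball [B] of a chart around a point
    of [A] cannot meet both the interior and the complement of [A].

    It does meet the interior: the preimage of [B] is a nonempty open subset of
    [M], hence uncountable since [m > 0], so it contains a regular point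
    ([open_avoids_countable]). Thus [B] misses the complement of [A], and [A] is
    a neighbourhood of each of its points ([nbhs_range]). Being closed, open and
    nonempty in the connected manifold [N], it is all of [N].

    The openness of submersions reduces to maps close to the identity: composed
    with an affine right inverse [w |-> x + w *m L] of its differential, a
    submersion becomes a map [h] of ['rV_n] to itself such that [h - id]
    contracts distances by 1/2 near 0, by the mean value inequality
    ([mean_value_ball]). For such an [h], a point minimising the distance of its
    image to a given target close to [h 0] must hit the target
    ([near_identity_open]). *)

Set Implicit Arguments.
Unset Strict Implicit.
Unset Printing Implicit Defensive.

Import Order.TTheory GRing.Theory Num.Theory.
Import numFieldNormedType.Exports.

Local Open Scope classical_set_scope.
Local Open Scope ring_scope.

(** * Countable sets in Euclidean space *)

Lemma itv_not_countable (R : realType) (a b : R) :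
  a < b -> ~ countable [set` `]a, b[%R].
Proof.
move=> ab /countable_lebesgue_measure0.
rewrite lebesgue_measure_itv/= lte_fin ab -EFinB => -[] /eqP.
by rewrite subr_eq0 gt_eqF.
Qed.

(** A countable set meets at most countably many members of a disjoint family,
    and an interval of indices is uncountable. Both the punctured lines through
    a point and the points of a curve are used as such families. *)
Lemma trivIset_avoid_countable (R : realType) (T : Type) (a b : R) (K : set T)
    (E : R -> set T) :
  a < b -> countable K -> trivIset [set` `]a, b[%R] E ->
  exists2 s, a < s < b & E s `&` K = set0.
Proof.
move=> ab /countable_injP[j jK] tE; apply: contrapT => noE.
(* Off the interval, g still needs some value, taken from the midpoint. *)
have wit s : exists x, a < s < b -> (E s `&` K) x.
  have [abs|nabs] := boolP (a < s < b); last first.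
    have [y _] : (E ((a + b) / 2) `&` K) !=set0.
      apply/set0P/negP => /eqP h; apply: noE.
      by exists ((a + b) / 2) => //; rewrite !midf_lt.
    by exists y.
  suff [x xs] : (E s `&` K) !=set0 by exists x.
  by apply/set0P/negP => /eqP h; apply: noE; exists s.
have /choice[g gP] := wit.
apply: (itv_not_countable ab); apply/countable_injP; exists (j \o g) => s t.
rewrite !inE/= !in_itv/= => abs abt.
have [[Es Ks] [Et Kt]] := (gP _ abs, gP _ abt).
move=> /jK; rewrite !inE => /(_ Ks Kt) gst.
by apply: tE; rewrite /= ?in_itv//; exists (g s); split => //; rewrite gst.
Qed.

Lemma ball_segment (R : realType) (V : normedModType R) (c z p : V) (e t : R) :
  ball c e z -> ball c e p -> 0 <= t <= 1 -> ball c e (z + t *: (p - z)).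
Proof.
rewrite -!ball_normE /= => cz cp /andP[t0 t1].
have -> : c - (z + t *: (p - z)) = (1 - t) *: (c - z) + t *: (c - p).
  have -> : c - p = (c - z) - (p - z) by rewrite opprB addrA subrK.
  by rewrite (scalerBr t (c - z)) scalerBl scale1r addrA subrK opprD addrA.
apply: (le_lt_trans (ler_normD _ _)).
rewrite !normrZ ger0_norm ?subr_ge0// ger0_norm//.
have [->|tn0] := eqVneq t 0; first by rewrite subr0 mul1r mul0r addr0.
have t_gt0 : 0 < t by rewrite lt_def tn0.
have : t * `|c - p| < t * e by rewrite ltr_pM2l.
have : (1 - t) * `|c - z| <= (1 - t) * e by rewrite ler_wpM2l ?subr_ge0// ltW.
lra.
Qed.

(** From [z] in [Q], the segments to the points [w + s *: u] near a point [w] of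
    [P], with [u] not parallel to [w - z], share only [z]; hence one of them
    avoids [K] except possibly at [z]. This segment is connected and covered by
    the disjoint open sets [P] and [Q], which both meet it. *)
Lemma ball_minus_countable_connected (R : realType) (n : nat) (c : 'rV[R]_n)
    (e : R) (K P Q : set 'rV[R]_n) :
  (2 <= n)%N -> countable K -> open P -> open Q -> P `&` Q = set0 ->
  ball c e `\` K `<=` P `|` Q ->
  ball c e `&` P !=set0 -> ball c e `&` Q = set0.
Proof.
move=> n2 cK oP oQ PQ0 BK [w [Bw Pw]]; apply/eqP/negP => /negP/set0P[z [Bz Qz]].
have nPQ x : P x -> Q x -> False.
  by move=> Px Qx; have : (P `&` Q) x by []; rewrite PQ0.
have [i wzi] : exists i, (w - z) 0 i != 0.
  apply/existsP; apply: contrapT => /negP; rewrite negb_exists => /forallP h.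
  have /subr0_eq wz : w - z = 0.
    by apply/rowP => i; have := h i; rewrite negbK mxE [RHS]mxE => /eqP.
  by apply: (nPQ z) => //; rewrite -wz.
have [j ji] : exists j : 'I_n, j != i.
  case: n n2 {c K P Q cK oP oQ PQ0 BK w Bw Pw z Bz Qz nPQ wzi} i
    => [//|[//|n]] _ i.
  by exists (lift i 0); rewrite eq_sym neq_lift.
(* w - z is nonzero at i, where u vanishes, so the two are independent. *)
pose u : 'rV[R]_n := delta_mx 0 j.
pose q s := w + s *: u.
(* The lines through z and q s, without their common point z. *)
pose E s := [set z + t *: (q s - z) | t in [set t | t != 0]].
have tE a b : trivIset [set` `]a, b[%R] E.
  move=> s t _ _ [_ [[r /eqP r0 <-]] [r' _] /addrI].
  move=> /rowP h; have := h i; have := h j.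
  rewrite !mxE /= !eqxx/= [in i == j]eq_sym (negbTE ji)/=.
  rewrite !mulr0 !addr0 !mulr1.
  have -> : w 0 i - z 0 i = (w - z) 0 i by rewrite !mxE.
  move=> hj /(mulIf wzi) rr'; rewrite rr' in hj.
  have rn0 : r != 0 by exact/eqP.
  by move/(mulfI rn0): hj => /addIr/addrI.
have oB : nbhs w (ball c e `&` P).
  by apply: open_nbhs_nbhs; split => //; apply: openI => //; exact: ball_open.
have cq : q s @[s --> (0 : R)] --> w.
  rewrite -[X in _ --> X]addr0 -(scale0r u).
  by apply: cvgD; [exact: cvg_cst|apply: cvgZr_tmp; exact: cvg_id].
have /nbhs_ballP[d /= d0 dq] := cq _ oB.
have [s /andP[s0 sd] EK] := trivIset_avoid_countable d0 cK (tE 0 d).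
have [Bq Pq] : (ball c e `&` P) (q s).
  by apply: dq; rewrite /ball/= sub0r normrN gtr0_norm.
pose g (t : R) := z + t *: (q s - z).
have cg : continuous g.
  move=> t; apply: cvgD; [exact: cvg_cst|apply: cvgZr_tmp; exact: cvg_id].
have PQg t : t \in `[0, 1] -> P (g t) \/ Q (g t).
  rewrite in_itv /= => t01; have [->|t0] := eqVneq t 0.
    by right; rewrite /g scale0r addr0.
  apply: BK; split; first exact: ball_segment.
  move=> Kg; have : (E s `&` K) (g t) by split => //; exists t.
  by rewrite EK.
have gPE : [set` `[0 : R, 1]] `&` g @^-1` P = [set` `[0, 1]].
  apply: segment_connected.
  - exists 1; split; first by rewrite /= in_itv/= ler01 lexx.
    by rewrite /= /g scale1r addrC subrK.
  - by exists (g @^-1` P) => //; apply: open_comp => // x _; exact: cg.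
  - exists (~` (g @^-1` Q)).
      by apply: open_closedC; apply: open_comp => // x _; exact: cg.
    apply/seteqP; split => t /= [t01 tP]; split => //.
      by move=> tQ; exact: (nPQ _ tP tQ).
    by have [|/tP] := PQg t t01.
have : [set` `[0 : R, 1]] 0 by rewrite /= in_itv/= ler01 lexx.
by rewrite -gPE => -[_]; rewrite /= /g scale0r addr0 => /nPQ; exact.
Qed.

(** * The mean value inequality and maps close to the identity *)

Lemma le_rV_norm (R : realType) n (v : 'rV[R]_n) (i : 'I_n) : `|v 0 i| <= `|v|.
Proof.
rewrite [leRHS]/Num.norm /= mx_normrE.
exact: (le_bigmax _ (fun ij : 'I_1 * 'I_n => `|v ij.1 ij.2|) (0, i)).
Qed.

Lemma rV_norm_le (R : realType) n (v : 'rV[R]_n) (k : R) :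
  0 <= k -> (forall i, `|v 0 i| <= k) -> `|v| <= k.
Proof.
move=> k0 vk; rewrite [leLHS]/Num.norm /= mx_normrE.
by apply: bigmax_le => // -[i j] _ /=; rewrite ord1.
Qed.

(** The norm of ['rV_n] is the largest coordinate, so it suffices to apply the
    scalar mean value theorem to each coordinate along a segment. *)
Lemma mean_value_ball (R : realType) (V : normedModType R) n
    (F : V -> 'rV[R]_n) (c : V) (r k : R) :
  0 <= k ->
  (forall x, ball c r x -> differentiable F x) ->
  (forall x v, ball c r x -> `|'d F x v| <= k * `|v|) ->
  forall u v, ball c r u -> ball c r v -> `|F u - F v| <= k * `|u - v|.
Proof.
move=> k0 dF bF u v Bu Bv; apply: rV_norm_le => [|j]; first by rewrite mulr_ge0.
pose g (t : R) := v + t *: (u - v).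
have Bg (t : R) : 0 <= t <= 1 -> ball c r (g t).
  by move=> t01; exact: ball_segment.
have gd (t : R) : is_diff t g ( *:%R^~ (u - v)).
  by apply: is_diff_eq; rewrite add0r.
have Fg (t : R) : 0 <= t <= 1 ->
    is_derive t 1 (fun s => F (g s) 0 j) ('d F (g t) (u - v) 0 j).
  move=> t01; have Fgt := differentiableP (dF _ (Bg t t01)).
  have dFg : differentiable (F \o g) t by [].
  have dvFg := diff_derivable (v := (1 : R)) dFg.
  apply: DeriveDef; first exact: (proj1 (derivable_mxP _ _ _) dvFg 0 j).
  have := derive_mx dvFg => /matrixP/(_ 0 j); rewrite mxE => <-.
  by rewrite deriveE// diff_val/= scale1r.
have [t t01] : exists2 t, t \in `]0, 1[%R &
    F (g 1) 0 j - F (g 0) 0 j = 'd F (g t) (u - v) 0 j * (1 - 0).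
  apply: (@MVT R (fun s => F (g s) 0 j)) => //.
    by move=> t; rewrite in_itv/= => /andP[? ?]; apply: Fg; rewrite !ltW.
  apply: derivable_within_continuous => t; rewrite in_itv/= => t01.
  by have [] := Fg t t01.
rewrite /g scale1r scale0r addr0 (addrC v) subrK subr0 mulr1 !mxE => ->.
rewrite in_itv/= in t01; case/andP: t01 => t0 t1.
by apply: le_trans (le_rV_norm _ _) (bF _ _ (Bg _ _)); rewrite !ltW.
Qed.

Lemma lipschitz_ball_continuous (R : realType) (V W : normedModType R)
    (h : V -> W) (c : V) (r k : R) :
  (forall u v, ball c r u -> ball c r v -> `|h u - h v| <= k * `|u - v|) ->
  forall u, ball c r u -> {for u, continuous h}.
Proof.
move=> hlip u Bu; apply/cvgrPdist_lt => /= d d0.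
have k0 : 0 < `|k| + 1 by rewrite ltr_pwDr.
have dk : 0 < d / (`|k| + 1) by rewrite divr_gt0.
have Br : \forall w \near u, ball c r w.
  by apply: open_nbhs_nbhs; split => //; exact: ball_open.
near=> w; have Bw : ball c r w by near: w.
apply: (le_lt_trans (hlip _ _ Bu Bw)).
apply: (@le_lt_trans _ _ ((`|k| + 1) * `|u - w|)).
  by rewrite ler_wpM2r// (le_trans (ler_norm k))// lerDl.
rewrite mulrC -ltr_pdivlMr//.
Unshelve. all: by end_near. Qed.

(** Given [y] close to [h c], the distance from [h v] to [y] has a minimum on the
    compact ball of radius [r / 2]. The step from the minimiser [v] to
    [w = v - (h v - y)] divides this distance by at least 2, and [w] stays in the
    ball; so the minimum is 0. *)
Lemma near_identity_open (R : realType) n (h : 'rV[R]_n -> 'rV[R]_n)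
    (c : 'rV[R]_n) (r : R) :
  0 < r ->
  (forall u v, ball c r u -> ball c r v ->
    `|(h u - h v) - (u - v)| <= 2^-1 * `|u - v|) ->
  nbhs (h c) (h @` ball c r).
Proof.
move=> r0 hh.
have hlip u v : ball c r u -> ball c r v -> `|h u - h v| <= 2 * `|u - v|.
  move=> Bu Bv; have := hh u v Bu Bv.
  have : `|h u - h v| <= `|(h u - h v) - (u - v)| + `|u - v|.
    by apply: le_trans (ler_normD _ _); rewrite subrK.
  have := normr_ge0 (u - v); lra.
have r2 : 0 < r / 2 by lra.
have r10 : 0 < r / 10 by lra.
have sB : closed_ball c (r / 2) `<=` ball c r.
  by apply: closed_ball_subset => //; lra.
(* With d = `|h c - y|, the bounds below give `|c - v| <= 4 * d and
   `|h v - y| <= d, so w lies within 5 * d of c; hence the radius r / 10. *)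
apply/nbhs_ballP; exists (r / 10) => //= y; rewrite -ball_normE/= => hcy.
have [] := @EVT_min_rV R n (fun v => `|h v - y|) (closed_ball c (r / 2)).
- by exists c; exact: closed_ballxx.
- apply: bounded_closed_compact; last exact: closed_ball_closed.
  exists (`|c| + r); split; first exact: num_real.
  move=> M cM u /= /sB; rewrite -ball_normE/= => cu.
  have := ler_normB c (c - u); rewrite subKr; lra.
- apply: continuous_in_subspaceT => u; rewrite inE => /sB Bu.
  have hu := lipschitz_ball_continuous hlip Bu.
  exact: (cvg_norm (cvgB hu (cvg_cst y))).
move=> v; rewrite inE => Bv vmin.
have {}vmin u : `|c - u| <= r / 2 -> `|h v - y| <= `|h u - y|.
  by move=> cu; apply: vmin; rewrite inE closed_ballE.
exists v; first by have := sB _ Bv; rewrite -ball_normE.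
apply/eqP; rewrite -subr_eq0 -normr_le0.
have hvy : `|h v - y| <= `|h c - y|.
  by apply: vmin; rewrite subrr normr0 ltW.
have Bc : ball c r c by exact: ballxx.
have hcv : `|c - v| <= 2 * `|h c - h v|.
  have := hh _ _ Bc (sB _ Bv).
  have := ler_normB (h c - h v) ((h c - h v) - (c - v)); rewrite subKr; lra.
have hchv : `|h c - h v| <= `|h c - y| + `|h v - y|.
  by have := ler_normB (h c - y) (h v - y); rewrite opprB addrA subrK.
pose w := v - (h v - y).
have cw : `|c - w| <= r / 2.
  have := ler_normD (c - v) (h v - y).
  have -> : c - v + (h v - y) = c - w by rewrite /w opprB [RHS]addrA addrAC.
  lra.
have Bw : ball c r w by apply: sB; rewrite closed_ballE.
have := vmin _ cw.
have := hh _ _ Bw (sB _ Bv).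
have -> : w - v = - (h v - y) by rewrite /w addrAC subrr add0r.
rewrite opprK addrA subrK normrN; lra.
Qed.

(** * Openness of submersions between Euclidean spaces *)

Lemma norm_linear_combination_le (R : realType) (V : normedModType R) n
    (a : 'I_n -> V) (y : 'rV[R]_n) :
  `|\sum_i y 0 i *: a i| <= (\sum_i `|a i|) * `|y|.
Proof.
apply: (le_trans (ler_norm_sum _ _ _)).
rewrite mulr_suml; apply: ler_sum => i _.
by rewrite normrZ mulrC ler_wpM2l// le_rV_norm.
Qed.

Lemma continuous_mulmxr (R : realType) m n (L : 'M[R]_(n, m)) :
  continuous (mulmxr L : 'rV[R]_n -> 'rV[R]_m).
Proof.
move=> w; apply: (@lipschitz_ball_continuous _ _ _ _ w 1 (\sum_i `|row i L|)).
  move=> u v _ _; rewrite /= -mulmxBl mulmx_sum_row.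
  exact: norm_linear_combination_le.
exact: ballxx.
Qed.

Lemma diff_idE (R : realType) (V : normedModType R) (x v : V) :
  'd (@id V) x v = v.
Proof. by rewrite diff_val. Qed.

Lemma continuous_sum_dist (R : realType) (V W : normedModType R) n
    (F : 'I_n -> V -> W) (a : 'I_n -> W) (x : V) :
  (forall i, {for x, continuous (F i)}) ->
  {for x, continuous (fun y => \sum_i `|F i y - a i|)}.
Proof.
move=> cF; apply: cvg_big => [|i _]; first exact: add_continuous.
by apply: cvg_norm; apply: cvgB; [exact: cF|exact: cvg_cst].
Qed.

(** The local submersion theorem, in the form that the image of a neighbourhood
    is a neighbourhood. The rows of [L] are preimages of the basis vectors under
    the differential at [x], so [h w = g (x + w *m L)] has the identity as
    differential at 0. The differentials of [h - id] are then controlled by their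
    values on the basis, whose total norm [S] is continuous and vanishes at 0. *)
Lemma submersion_nbhs (R : realType) m n (g : 'rV[R]_m -> 'rV[R]_n)
    (U O : set 'rV[R]_m) (x : 'rV[R]_m) :
  Ck_on 1 U g -> nbhs x U -> (forall w, exists v, 'd g x v = w) ->
  nbhs x O -> nbhs (g x) (g @` O).
Proof.
move=> [dg cdg] xU /choice[s sP] xO.
pose L : 'M[R]_(n, m) := \matrix_i s (delta_mx 0 i).
pose A (w : 'rV[R]_n) := x + w *m L.
have dA w : is_diff w A (mulmxr L).
  have -> : A = cst x + mulmxr L by [].
  apply: (@is_diff_eq _ _ _ _ (0 + mulmxr L)); last by rewrite add0r.
  apply: is_diffD; apply: DiffDef; last first.
    exact: diff_lin (@continuous_mulmxr _ _ _ L).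
  exact: linear_differentiable (@continuous_mulmxr _ _ _ L).
have A0 : A 0 = x by rewrite /A mul0mx addr0.
have cA : {for 0, continuous A}.
  by apply: differentiable_continuous; apply: ex_diff.
have AUO : \forall w \near (0 : 'rV[R]_n), (U `&` O) (A w).
  by apply: cA; rewrite A0; exact: filterI.
pose h := g \o A.
have dh w : U (A w) -> differentiable h w.
  by move=> UA; apply: differentiable_comp; [exact: ex_diff|exact: dg].
have dhE w v : U (A w) -> 'd h w v = 'd g (A w) (v *m L).
  move=> UA; have dAw : differentiable A w by exact: ex_diff.
  rewrite /h (diff_comp dAw (dg _ UA)) /=; congr ('d g _ _).
  by rewrite (diff_val (f := A)).
pose S w := \sum_(i < n) `|'d g (A w) (row i L) - delta_mx 0 i|.
have S0 : S 0 = 0.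
  rewrite /S big1// => i _; apply/eqP; rewrite normr_eq0 subr_eq0; apply/eqP.
  by rewrite A0 rowK sP.
have cS : {for 0, continuous S}.
  apply: continuous_sum_dist => i.
  have cdx : {for A 0, continuous (fun y => 'd g y (row i L))}.
    rewrite A0; apply: cdg; exact: nbhs_singleton xU.
  exact: (continuous_comp cA cdx).
have Slt : \forall w \near (0 : 'rV[R]_n), S w < 2^-1.
  by apply: (cvgr_lt _ cS); rewrite S0 invr_gt0.
have /nbhs_ballP[r /= r0 rP] :
    nbhs (0 : 'rV[R]_n) [set w | (U `&` O) (A w) /\ S w < 2^-1].
  exact: filterI.
have := @near_identity_open R n h 0 r r0 _.
rewrite /h /= A0 => H.
have {H} : nbhs (g x) [set (g \o A) x | x in ball 0 r].
  apply: H => u v Bu Bv.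
  have -> : g (A u) - g (A v) - (u - v) = (h - id) u - (h - id) v.
    by rewrite !fctE /h /= !opprB [LHS]addrACA [RHS]addrACA [- u - _]addrC.
  have k0 : 0 <= 2^-1 :> R by rewrite invr_ge0.
  refine (@mean_value_ball R 'rV[R]_n n (h - id) 0 r 2^-1 k0 _ _ u v Bu Bv)
    => [w /rP[[UA _] _]|w y /rP[[UA _] Sw]].
    by apply: differentiableB; first exact: dh.
  have -> : 'd (h - id) w y =
      \sum_i y 0 i *: ('d g (A w) (row i L) - delta_mx 0 i).
    transitivity ('d h w y - 'd (@id 'rV[R]_n) w y).
      have did : differentiable (@id 'rV[R]_n) w by exact: ex_diff.
      exact: (congr1 (fun F => F y) (diffB (dh w UA) did)).
    transitivity ('d g (A w) (y *m L) - y).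
      exact: (congr2 (fun a b => a - b) (dhE w y UA) (diff_idE w y)).
    rewrite mulmx_sum_row linear_sum [X in _ - X]row_sum_delta -sumrB.
    by apply: eq_bigr => i _; rewrite linearZ/= scalerBr.
  apply: (le_trans (norm_linear_combination_le _ _)).
  by rewrite ler_wpM2r// ltW.
by apply: filterS => _ [w /rP[[_ OA] _] <-]; exists (A w).
Qed.

(** * Charts, tangent vectors and open subsets of manifolds *)

Lemma diff_near_id (R : realType) (V : normedModType R) (F : V -> V)
    (x v : V) :
  differentiable F x -> (\near x, F x = x) -> 'd F x v = v.
Proof.
by move=> dF Fid; rewrite -(deriveE v dF) (near_eq_derive v Fid) derive_id.
Qed.

Lemma cdom_nbhs (R : realType) n (X : topologicalType) (a : chart R n X)
    (p : X) :
  cdom a p -> nbhs p (cdom a).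
Proof. by move=> ap; apply: open_nbhs_nbhs; split => //; exact: cdom_open. Qed.

Lemma cimg_nbhs (R : realType) n (X : topologicalType) (a : chart R n X)
    (x : 'rV[R]_n) :
  (cmap a @` cdom a) x -> nbhs x (cmap a @` cdom a).
Proof. by move=> ax; apply: open_nbhs_nbhs; split => //; exact: cimg_open. Qed.

Lemma chart_nbhs (R : realType) n (X : topologicalType) (a : chart R n X)
    (p : X) (O : set X) :
  cdom a p -> nbhs p O -> nbhs (cmap a p) (cmap a @` (cdom a `&` O)).
Proof.
move=> ap pO.
have aV := cimg_nbhs (imageP (cmap a) ap).
have aO : nbhs (cmap a p) (cinv a @^-1` O).
  by apply: (cinv_continuous (imageP _ ap)); rewrite cmapK.
apply: filterS (filterI aV aO) => _ [[q aq <-]] /=.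
by rewrite cmapK// => Oq; exists q.
Qed.

(** A tangent vector is determined by its coordinates in one chart, which are
    arbitrary: the coordinates in the other charts are the images under the
    differentials of the transition maps, compatible by the chain rule. *)
Lemma ex_tangent (R : realType) n (N : manifold R n) (q : N) (b : chart_at q)
    (w : 'rV[R]_n) :
  exists t : tangent q, tcoord t b = w.
Proof.
have dT (c d : chart_at q) :
    differentiable (transition (sval c) (sval d)) (cmap (sval c) q).
  case: c d => c [Ac cq] [d [Ad dq]] /=.
  by have [+ _] := atlas_smooth Ac Ad 1; apply; exists q.
pose co (c : chart_at q) :=
  'd (transition (sval b) (sval c)) (cmap (sval b) q) w.
have coE c d : co d = 'd (transition (sval c) (sval d)) (cmap (sval c) q) (co c).
  apply: near_diff_comp (dT b c) (dT c d) (dT b d) _.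
    by rewrite /transition /= cmapK//; case: (b) => ? [].
  have [_ cq] := svalP c; have [_ bq] := svalP b.
  have := chart_nbhs bq (cdom_nbhs cq).
  by apply: filterS => _ [p [bp cp] <-]; rewrite /transition /= !cmapK.
exists (Tangent coE) => /=.
apply: (diff_near_id _ (dT b b)).
have [_ bq] := svalP b.
have := chart_nbhs bq (cdom_nbhs bq).
by apply: filterS => _ [p [bp cp] <-]; rewrite /transition /= !cmapK.
Qed.

(** A chart carries the open set to a neighbourhood in ['rV_m], which contains a
    whole interval of a line because [m > 0]. *)
Lemma open_avoids_countable (R : realType) m (M : manifold R m) (p : M)
    (O K : set M) :
  (0 < m)%N -> nbhs p O -> countable K -> exists2 q, O q & ~ K q.
Proof.
case: m M p O K => // m M p O K _ pO cK.
have [a Aa ap] := atlas_cover p.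
pose l (t : R) : 'rV[R]_m.+1 := cmap a p + t *: const_mx 1.
pose E t := [set q | [/\ cdom a q, O q & cmap a q = l t]].
have cl : l t @[t --> (0 : R)] --> cmap a p.
  rewrite -[X in _ --> X]addr0 -(scale0r (const_mx 1)).
  by apply: cvgD; [exact: cvg_cst|apply: cvgZr_tmp; exact: cvg_id].
have /nbhs_ballP[d /= d0 dO] := cl _ (chart_nbhs ap pO).
have tE : trivIset [set` `]0, d[%R] E.
  move=> s t _ _ [q [[_ _ qs] [_ _]]]; rewrite qs => /addrI/rowP/(_ 0).
  by rewrite !mxE !mulr1.
have [s /andP[s0 sd] EK0] := trivIset_avoid_countable d0 cK tE.
have [|q [aq Oq] qs] := dO s; first by rewrite /ball/= sub0r normrN gtr0_norm.
exists q => // Kq; have : (E s `&` K) q by [].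
by rewrite EK0.
Qed.

(** * The range of a map with countably many critical points *)

Lemma regular_diff_surjective (R : realType) (m n : nat)
    (M : manifold R m) (N : manifold R n) (f : M -> N) (fC1 : C1_map f) (p : M)
    (a : chart_at p) (b : chart_at (f p)) :
  ~ critical_points fC1 p ->
  forall w, exists v,
    'd (local_repr f (sval a) (sval b)) (cmap (sval a) p) v = w.
Proof.
move=> /contrapT sf w.
have [t <-] := ex_tangent b w.
have [u _ <-] := sf t I.
by exists (tcoord u a); rewrite (differentialE fC1 u a b).
Qed.

Lemma nbhs_range_regular (R : realType) (m n : nat)
    (M : manifold R m) (N : manifold R n) (f : M -> N) (fC1 : C1_map f) (p : M) :
  ~ critical_points fC1 p -> nbhs (f p) (range f).
Proof.
move=> regp.
have [a Aa ap] := atlas_cover p.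
have [b Ab bp] := atlas_cover (f p).
pose U := cmap a @` (cdom a `&` f @^-1` cdom b).
have aU : nbhs (cmap a p) U.
  by apply: chart_nbhs => //; apply: fC1.1; exact: cdom_nbhs.
have sg := regular_diff_surjective (exist _ a (conj Aa ap))
  (exist _ b (conj Ab bp)) regp.
have := submersion_nbhs (fC1.2 a b Aa Ab) aU sg aU.
rewrite /local_repr /= cmapK// => /(cmap_continuous bp) fU.
apply: filterS (filterI (cdom_nbhs bp) fU) => y [by_ [_ [q [aq bfq] <-]]].
rewrite /= cmapK// => bfqy; exists q => //.
by rewrite -(cmapK bfq) bfqy cmapK.
Qed.

(** In a chart ball [B] around [f p], the preimages of the interior and of the
    complement of the range are disjoint open sets that cover [B] up to the
    countable set [K] of critical values, and the first one is nonempty. *)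
Lemma nbhs_range (R : realType) (m n : nat)
    (M : manifold R m) (N : manifold R n) (f : M -> N) (fC1 : C1_map f) (p : M) :
  (0 < m)%N -> (2 <= n)%N -> closed (range f) ->
  countable (critical_points fC1) ->
  nbhs (f p) (range f).
Proof.
move=> m_gt0 n_ge2 f_closed f_crit.
have [b Ab bp] := atlas_cover (f p).
pose V := cmap b @` cdom b.
have /nbhs_ballP[e /= e0 eV] := cimg_nbhs (imageP (cmap b) bp).
pose B := ball (cmap b (f p)) e.
pose pull (O : set N) := V `&` cinv b @^-1` O.
have opull O : open O -> open (pull O).
  move=> oO; rewrite openE => x [Vx Ox].
  apply: filterI; [exact: cimg_nbhs|apply: (cinv_continuous Vx)].
  by apply: open_nbhs_nbhs.
pose K := (cmap b \o f) @` critical_points fC1.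
have cK : countable K by exact: sub_countable (card_image_le _ _) f_crit.
have BK : B `\` K `<=` pull (range f)° `|` pull (~` range f).
  move=> x [/eV Vx Kx].
  have [[q _ fq]|nr] := pselect (range f (cinv b x)); last by right.
  left; split => //=; rewrite -fq; apply: nbhs_range_regular => cq.
  by apply: Kx; exists q => //=; rewrite fq; case: Vx => y by_ <-; rewrite cmapK.
have PQ0 : pull (range f)° `&` pull (~` range f) = set0.
  by rewrite -subset0 => x [[_ /= /interior_subset rx] [_]].
have fpB : nbhs (f p) (cdom b `&` cmap b @^-1` B).
  apply: filterI; first exact: cdom_nbhs.
  by apply: (cmap_continuous bp); exact: nbhsx_ballx.
have BP : B `&` pull (range f)° !=set0.
  have [q [bq Bq] rq] := open_avoids_countable m_gt0 (fC1.1 p _ fpB) f_crit.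
  exists (cmap b (f q)); split => //; split; first by exists (f q).
  by rewrite /= cmapK//; exact: nbhs_range_regular.
have BQ0 := ball_minus_countable_connected n_ge2 cK
  (opull _ (@open_interior _ _)) (opull _ (closed_openC f_closed)) PQ0 BK BP.
apply: filterS fpB => y [by_ By]; apply: contrapT => nry.
have : (B `&` pull (~` range f)) (cmap b y).
  by split => //; split; [exists y|rewrite /= cmapK].
by rewrite BQ0.
Qed.

Theorem corollary1p2 (R : realType) (m n : nat)
    (M : manifold R m) (N : manifold R n) (f : M -> N)
    (m_gt0 : (0 < m)%N) (M_neq0 : [set: M] !=set0)
    (n_ge2 : (2 <= n)%N) (N_connected : connected [set: N])
    (fC1 : C1_map f)
    (f_closed : closed (range f))
    (f_crit : countable (critical_points fC1)) :
  set_surj [set: M] [set: N] f.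
Proof.
have [p _] := M_neq0.
have fT : range f = [set: N].
  apply: N_connected; first by exists (f p), p.
  - exists (range f); last by rewrite setTI.
    rewrite openE => _ [q _ <-].
    exact: (nbhs_range q m_gt0 n_ge2 f_closed f_crit).
  - by exists (range f) => //; rewrite setTI.
by move=> y _; rewrite fT.
Qed.
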